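(* Let $V_\gamma^{(i,j)}, u_\gamma^{(i)}, w_\gamma^{(i,j)}$ be generated by the deterministic policy iteration described in the context. Fix $i\ge 0$. Suppose that for every $j\ge 0$ the system $$\dot y(t)=f(y(t))+g(y(t))u_\gamma^{(i)}(y(t))+h(y(t))w_\gamma^{(i,j)}(y(t)),\qquad y(0)=x,$$ is asymptotically stable in the sense of Lyapunov on $\Omega$, and that $V_\gamma^{(i,j)}\in C^1(\mathbb{R}^d)$ for every $j\ge 0$. Then for all $j\ge 0$ and all $x\in\Omega$ $$0\le V_\gamma^{(i,j)}(x)\le V_\gamma^{(i,j+1)}(x)\le V_\gamma^{(i)}(x),$$ where $V_\gamma^{(i)}(x)=\max_{w\in L^2(\mathbb{R}_+;\mathbb{R}^q)}\mathcal{J}(u_\gamma^{(i)},w;x)$. Moreover, $V_\gamma^{(i,j)}(x)>0$ for all $x\in\Omega$ with $x\neq 0$.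
   Context: **Setting.** $f:\mathbb{R}^d\to\mathbb{R}^d$ with $f(0)=0$, $g:\mathbb{R}^d\to\mathbb{R}^{d\times m}$, $h:\mathbb{R}^d\to\mathbb{R}^{d\times q}$ are uniformly Lipschitz continuous on $\mathbb{R}^d$, and $g,h$ are globally bounded. $\ell:\mathbb{R}^d\to\mathbb{R}$ satisfies $\ell(0)=0$ and $\ell(y)>0$ for $y\ne0$. $R\in\mathbb{R}^{m\times m}$ and $P\in\mathbb{R}^{q\times q}$ are (symmetric) positive definite matrices, $\|u\|_R^2=u^tRu$, $\|w\|_P^2=w^tPw$. $U\subset\mathbb{R}^m$ is closed and convex with $0\in U$, and $\mathcal{P}_U$ is the orthogonal projection of $\mathbb{R}^m$ onto $U$ with respect to the $R$-weighted inner product. The controlled system is $$\dot y=f(y)+g(y)u+h(y)w,\quad y(0)=x,$$ and the cost is $$\mathcal{J}(u,w;x)=\int_0^\infty\big(\ell(y(t))+\|u(t)\|_R^2-\gamma^2\|w(t)\|_P^2\big)\,dt,$$ where $u\in L^2(\mathbb{R}_+;U)$ and $w\in L^2(\mathbb{R}_+;\mathbb{R}^q)$. If $u=u(\cdot)$ is a feedback law, $\mathcal{J}(u,w;x)$ is evaluated along $\dot y=f(y)+g(y)u(y)+h(y)w(t)$, $y(0)=x$, with $u(t)=u(y(t))$. $\Omega\subset\mathbb{R}^d$ is a fixed domain containing the origin in its interior, and $\bar\Omega$ is contained in the set of initial conditions whose trajectories can be asymptotically stabilized to the origin when $w=0$. The number $\gamma>0$ is fixed with $\gamma\ge\gamma^*$,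 where $\gamma^*$ is the smallest value such that for all $\gamma\ge\gamma^*$ there is a feedback control making the closed loop asymptotically stable and satisfying $\int_0^T(\ell(y)+\|u\|_R^2)\,dt\le\gamma^2\int_0^T\|w\|_P^2\,dt$ for all $T\ge0$, $w\in L^2(0,T;\mathbb{R}^q)$, with $y(0)=0$. Standing assumption: the value function $V_\gamma(x)=\min_u\max_w\mathcal{J}(u,w;x)$ is radially unbounded and in $C^1(\mathbb{R}^d)$, and $V_\gamma^{(i,j)}\in C^1(\mathbb{R}^d)$ for all $i,j\ge0$. **Policy iteration.** $u_\gamma^{(0)}:\mathbb{R}^d\to U$ is an asymptotically stabilizing feedback law for the system with $w=0$. For $i=0,1,2,\dots$: set $w_\gamma^{(i,0)}\equiv0$, and for $j=0,1,2,\dots$ let $V_\gamma^{(i,j)}\in C^1(\mathbb{R}^d)$ solve $$\nabla V_\gamma^{(i,j)}(x)^t\big(f(x)+g(x)u_\gamma^{(i)}(x)+h(x)w_\gamma^{(i,j)}(x)\big)+\ell(x)+\|u_\gamma^{(i)}(x)\|_R^2-\gamma^2\|w_\gamma^{(i,j)}(x)\|_P^2=0,\quad V_\gamma^{(i,j)}(0)=0,$$ and set $w_\gamma^{(i,j+1)}(x)=\frac{1}{2\gamma^2}P^{-1}h(x)^t\nabla V_\gamma^{(i,j)}(x)$. With $V_\gamma^{(i,\infty)}=\lim_{j\to\infty}V_\gamma^{(i,j)}$ (convergence of the inner loop being assumed when passing to the next $i$), set $u_\gamma^{(i+1)}(x)=\mathcal{P}_U\big(-\frac12R^{-1}g(x)^t\nabla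 V_\gamma^{(i,\infty)}(x)\big)$. **Stability.** A system with equilibrium $y=0$ is asymptotically stable in the sense of Lyapunov on $\Omega$ if (1) for every $\epsilon>0$ there is $\delta>0$ such that $\|x\|<\delta$ implies $\|y(t)\|<\epsilon$ for all $t>0$, and (2) $y(t)\to0$ as $t\to\infty$ for every initial condition $x\in\Omega$. *)

(* Defs.v *)
From HB Require Import structures.
From mathcomp Require Import all_boot all_order all_algebra.
From mathcomp Require Import all_classical all_reals all_analysis.

Set Implicit Arguments.
Unset Strict Implicit.
Unset Printing Implicit Defensive.

Import Order.TTheory GRing.Theory Num.Theory.
Import numFieldNormedType.Exports.

Local Open Scope classical_set_scope.
Local Open Scope ring_scope.

(* Vectors of R^n are columns.  `|x| is the library norm on matrices (largest
   absolute value of an entry); it is only used for notions that do not depend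
   on the choice of a norm on R^n. *)

Section vectors.
Context {R : realType}.

Definition wnorm2 n (A : 'M[R]_n) (v : 'cV[R]_n) : R := (v^T *m A *m v) 0 0.

Definition posdef n (A : 'M[R]_n) : Prop :=
  A^T = A /\ forall v : 'cV[R]_n, v != 0 -> 0 < wnorm2 A v.

Definition gradient d (V : 'cV[R]_d -> R) (x : 'cV[R]_d) : 'cV[R]_d :=
  \col_k 'D_(delta_mx k 0) (V : 'cV[R]_d -> R^o) x.

Definition C1 d (V : 'cV[R]_d -> R) : Prop :=
  (forall x, differentiable (V : 'cV[R]_d -> R^o) x) /\
  continuous (gradient V).

Definition radially_unbounded d (V : 'cV[R]_d -> R) : Prop :=
  forall M : R, exists r : R, forall x, r < `|x| -> M < V x.

(* p is the orthogonal projection of v onto U in the inner product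
   (v1, v2) |-> v1^T A v2, i.e. the nearest point of U. *)
Definition is_wproj n (A : 'M[R]_n) (U : set 'cV[R]_n) (v p : 'cV[R]_n)
    : Prop :=
  U p /\ forall z, U z -> wnorm2 A (v - p) <= wnorm2 A (v - z).

Definition measurable_vec n (D : set R) (w : R -> 'cV[R]_n) : Prop :=
  forall k, measurable_fun D (fun t => w t k 0).

Definition integrable_vec n (D : set R) (w : R -> 'cV[R]_n) : Prop :=
  forall k, lebesgue_measure.-integrable D (fun t => (w t k 0)%:E).

Definition L2 n (D : set R) (w : R -> 'cV[R]_n) : Prop :=
  measurable_vec D w /\
  forall k, lebesgue_measure.-integrable D (fun t => (w t k 0 ^+ 2)%:E).

Definition integral_vec n (D : set R) (w : R -> 'cV[R]_n) : 'cV[R]_n :=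
  \col_k \int[lebesgue_measure]_(t in D) w t k 0.

End vectors.

Record game (R : realType) (d m q : nat) := Game {
  fdyn : 'cV[R]_d -> 'cV[R]_d;
  gdyn : 'cV[R]_d -> 'M[R]_(d, m);
  hdyn : 'cV[R]_d -> 'M[R]_(d, q);
  ell : 'cV[R]_d -> R;
  Rmat : 'M[R]_m;
  Pmat : 'M[R]_q;
  Uset : set 'cV[R]_m }.

Section game_theory.
Context {R : realType} {d m q : nat}.
Implicit Types (S : game R d m q) (x : 'cV[R]_d) (y : R -> 'cV[R]_d)
  (Omega : set 'cV[R]_d).

Record game_assumptions S : Prop := GameAssumptions {
  f_eq0 : fdyn S 0 = 0;
  f_lipschitz : exists k : R, k.-lipschitz (fdyn S);
  g_lipschitz : exists k : R, k.-lipschitz (gdyn S);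
  h_lipschitz : exists k : R, k.-lipschitz (hdyn S);
  g_bounded : exists M : R, forall x, `|gdyn S x| <= M;
  h_bounded : exists M : R, forall x, `|hdyn S x| <= M;
  ell_eq0 : ell S 0 = 0;
  ell_gt0 : forall x, x != 0 -> 0 < ell S x;
  R_posdef : posdef (Rmat S);
  P_posdef : posdef (Pmat S);
  U_closed : closed (Uset S);
  U_convex : convex_set (Uset S);
  U_0 : Uset S 0 }.

(* Solutions on a time interval D with left end point 0 are meant in the sense
   of Caratheodory, since the inputs are only square integrable and a feedback
   law need not be continuous. *)
Definition trajectory S (D : set R) x (u : R -> 'cV[R]_m) (w : R -> 'cV[R]_q)
    y : Prop :=
  let rhs := fun s => fdyn S (y s) + gdyn S (y s) *m u s
                      + hdyn S (y s) *m w s in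
  [/\ measurable_vec D u, measurable_vec D w, {within D, continuous y} &
      forall t, D t -> integrable_vec `[0, t] rhs /\
                       y t = x + integral_vec `[0, t] rhs].

(* Closed loop for the feedback laws u = uf(y) and w = wf(y). *)
Definition closed_loop S (uf : 'cV[R]_d -> 'cV[R]_m)
    (wf : 'cV[R]_d -> 'cV[R]_q) x y : Prop :=
  trajectory S `[0, +oo[ x (uf \o y) (wf \o y) y.

(* [sys x y] says that y is a solution with y(0) = x.  Solutions of a closed
   loop need be neither global nor unique a priori: global existence is part
   of the notion, and the conditions bear on every solution. *)
Record asymptotically_stable (sys : 'cV[R]_d -> (R -> 'cV[R]_d) -> Prop)
    Omega : Prop := AsymptoticallyStable {
  as_equilibrium : sys 0 (fun=> 0);
  as_stable : forall eps : R, 0 < eps -> exists2 delta : R, 0 < delta &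
    forall x, `|x| < delta -> (exists y, sys x y) /\
      forall y, sys x y -> forall t : R, 0 < t -> `|y t| < eps;
  as_attractive : forall x, Omega x -> (exists y, sys x y) /\
      forall y, sys x y -> y t @[t --> +oo] --> (0 : 'cV[R]_d) }.

Definition control_feedback S (uf : 'cV[R]_d -> 'cV[R]_m) : Prop :=
  forall x, Uset S (uf x).

(* Initial conditions that can be asymptotically stabilized when w = 0. *)
Definition stabilizable S : set 'cV[R]_d :=
  [set x | exists2 uf, control_feedback S uf &
             asymptotically_stable (closed_loop S uf (fun=> 0)) [set x]].

Definition L2_gain_le S Omega (gam : R) : Prop :=
  exists uf, [/\ control_feedback S uf,
    asymptotically_stable (closed_loop S uf (fun=> 0)) Omega &
    forall (T : R) (w : R -> 'cV[R]_q), 0 <= T -> L2 `[0, T] w ->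
      (exists y, trajectory S `[0, T] 0 (uf \o y) w y) /\
      forall y, trajectory S `[0, T] 0 (uf \o y) w y ->
        (\int[lebesgue_measure]_(t in `[0%R, T])
            (ell S (y t) + wnorm2 (Rmat S) (uf (y t)))%:E
         <= (gam ^+ 2)%:E * \int[lebesgue_measure]_(t in `[0%R, T])
            (wnorm2 (Pmat S) (w t))%:E)%E].

Definition is_gamma_star S Omega (gs : R) : Prop :=
  [/\ 0 <= gs, forall gam, gs <= gam -> L2_gain_le S Omega gam &
      forall s, 0 <= s -> (forall gam, s <= gam -> L2_gain_le S Omega gam) ->
        gs <= s].

Definition cost S (gam : R) (u : R -> 'cV[R]_m) (w : R -> 'cV[R]_q) y
    : \bar R :=
  (\int[lebesgue_measure]_(t in `[0%R, +oo[)
     (ell S (y t) + wnorm2 (Rmat S) (u t)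
      - gam ^+ 2 * wnorm2 (Pmat S) (w t))%:E)%E.

(* max_w J(uf, w; x) over w in L2(R_+; R^q), as a supremum in the extended
   reals; if the closed loop has several solutions for some w, all of them are
   taken into account. *)
Definition worst_cost S (gam : R) (uf : 'cV[R]_d -> 'cV[R]_m) x : \bar R :=
  ereal_sup [set c | exists w y, [/\ L2 `[0, +oo[ w,
    trajectory S `[0, +oo[ x (uf \o y) w y &
    c = cost S gam (uf \o y) w y]].

(* min_u max_w J(u, w; x), over the feedback laws for which J(u, w; x) makes
   sense for all w. *)
Definition value S (gam : R) x : \bar R :=
  ereal_inf [set worst_cost S gam uf x | uf in
    [set uf | control_feedback S uf /\
       forall w, L2 `[0, +oo[ w ->
         exists y, trajectory S `[0, +oo[ x (uf \o y) w y]].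

Record policy_iteration S Omega (gam : R)
    (u : nat -> 'cV[R]_d -> 'cV[R]_m)
    (w : nat -> nat -> 'cV[R]_d -> 'cV[R]_q)
    (V : nat -> nat -> 'cV[R]_d -> R)
    (Vinf : nat -> 'cV[R]_d -> R) : Prop := PolicyIteration {
  pi_u0 : control_feedback S (u 0%N);
  pi_u0_stabilizing :
    asymptotically_stable (closed_loop S (u 0%N) (fun=> 0)) Omega;
  pi_w0 : forall i x, w i 0%N x = 0;
  pi_V_pde : forall i j x,
    ((gradient (V i j) x)^T *m
      (fdyn S x + gdyn S x *m u i x + hdyn S x *m w i j x)) 0 0
    + ell S x + wnorm2 (Rmat S) (u i x)
    - gam ^+ 2 * wnorm2 (Pmat S) (w i j x) = 0;
  pi_V_0 : forall i j, V i j 0 = 0;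
  pi_w : forall i j x, w i j.+1 x =
    (2 * gam ^+ 2)^-1 *: (invmx (Pmat S) *m (hdyn S x)^T
                          *m gradient (V i j) x);
  pi_Vinf : forall i x, V i j x @[j --> \oo] --> Vinf i x;
  (* needed for the gradient in the next update to make sense *)
  pi_Vinf_diff : forall i x,
    differentiable (Vinf i : 'cV[R]_d -> R^o) x;
  pi_u : forall i x, is_wproj (Rmat S) (Uset S)
    (- 2^-1 *: (invmx (Rmat S) *m (gdyn S x)^T *m gradient (Vinf i) x))
    (u i.+1 x) }.

End game_theory.

(* Main.v *)
Require Import Defs.
From HB Require Import structures.
From mathcomp Require Import all_boot all_order all_algebra.
From mathcomp Require Import all_classical all_reals all_analysis measurable_realfun.
From mathcomp Require Import lra ring.
Import Order.TTheory GRing.Theory Num.Theory.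
Import numFieldNormedType.Exports.
Local Open Scope classical_set_scope.
Local Open Scope ring_scope.

(** Along a solution [y] of a closed loop, the equation defining [V j] computes
    the rate of change of [V j (y t)].  Completing the square in the
    disturbance, and using that [w j.+1] is the maximizer attached to the
    gradient of [V j], one finds for every disturbance [v]
<<
      d/dt V_j(y) = - (ell + |u|^2 - gam^2 |v|^2)
                    - gam^2 |v - w_(j+1)|^2 + gam^2 |w_(j+1) - w_j|^2
>>
    where the first bracket is the running cost ([completed_square],
    [lie_derivativeE]).  Integrating this along well-chosen trajectories and
    letting the time go to infinity, where [V j (y t)] tends to [V j 0 = 0] by
    stability, gives all the claims.

    - For [v = w_0 = 0], the running cost is at least [ell > 0], so that
      [V 0 x] is the integral of a positive function ([evaluation0_gt0]).
    - For [v = w_(j+1)], the derivatives of [V j] and [V j.+1] differ by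
      [gam^2 |w_(j+1) - w_j|^2 >= 0], hence [V j.+1 - V j] decreases to 0 along
      the trajectory and was nonnegative at its start ([evaluation_monotone]).
    - The feedback [w_j] need not be square integrable on the half-line along
      its own trajectory, so it does not compete directly in the worst-case
      cost.  It is therefore applied up to a large time [T], for which the state
      [y T] is near the origin, hence in [Omega], and replaced by the zero
      disturbance afterwards.  The solution continues because [w_0 = 0]
      stabilizes from [y T], the cost incurred after [T] is nonnegative, and the
      cost up to [T] is [V j x - V j (y T)] ([truncated_le_worst_cost]); then
      [T] goes to infinity ([evaluation_le_worst_cost]).

    The analytic ingredient is the chain rule for a [C1] function along a curve
    which is only the integral of an integrable velocity ([C1_chain_rule]).
    Such a curve may fail to be differentiable at some points; the rule is
    obtained from the comparison of the increments of both sides with the arc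
    length ([constant_of_small_increments]). *)

Set Implicit Arguments.
Unset Strict Implicit.
Unset Printing Implicit Defensive.

(** * Functions with negligible increments *)

(** [A] plays the role of an arc length: increments of [G] are compared with those
    of [A] instead of with [t - s], because [G] may have no derivative at times.
    For each [e], the set of times up to which [|G - G 0| <= e (A - A 0)] is
    closed under passing to its supremum and can be continued beyond it, so it
    is the whole interval. *)
Lemma constant_of_small_increments (R : realType) (G A : R -> R) (T : R) :
  0 <= T ->
  {in `[0, T] &, {homo A : s t / s <= t}} ->
  (forall e, 0 < e -> forall s, 0 <= s <= T ->
     \forall t \near s, 0 <= t <= T -> `|G t - G s| <= e * `|A t - A s|) ->
  G T = G 0.
Proof.
move=> T0 Amono loc.
have domination e : 0 < e -> `|G T - G 0| <= e * (A T - A 0).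
  move=> e0.
  pose good t := 0 <= t <= T /\ `|G t - G 0| <= e * (A t - A 0).
  (* Goodness is required on the whole past, so that [E] is an interval and
     every time below its supremum is good. *)
  pose E := [set t | 0 <= t <= T /\ forall s, 0 <= s <= t -> good s].
  have E0 : E 0.
    split; first by rewrite lexx.
    move=> s /le_anti <-; split; first by rewrite lexx.
    by rewrite !subrr normr0 mulr0.
  have ubE : ubound E T by move=> t [/andP[]].
  have supE : has_sup E by split; [exists 0|exists T].
  pose c := sup E.
  have c0 : 0 <= c by apply: ub_le_sup; [exists T|].
  have cT : c <= T by apply: ge_sup; [exists 0|].
  have c0T : 0 <= c <= T by rewrite c0.
  have step s t : 0 <= s -> s <= t -> t <= T -> `|G t - G s| <= e * `|A t - A s| ->
      good s -> good t.
    move=> s0 st tT Gts [_ Gs]; split; first by rewrite (le_trans s0 st).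
    have : `|A t - A s| = A t - A s.
      by rewrite ger0_norm// subr_ge0 Amono ?in_itv//= ?s0 ?(le_trans s0)// (le_trans st).
    move=> As; rewrite As in Gts.
    have -> : G t - G 0 = (G t - G s) + (G s - G 0) by lra.
    apply: le_trans (ler_normD _ _) _.
    by apply: le_trans (lerD Gts Gs) _; lra.
  have /nbhs_ballP[r /= r0 near_c] := loc e e0 c c0T.
  have [s [[s0T sgood] cs]] : exists s, E s /\ c - r < s.
    by have [s Es cs] := sup_adherent r0 supE; exists s.
  have sc : s <= c by apply: ub_le_sup; [exists T|split].
  have good_c : good c.
    move: s0T => /andP[s0 sT].
    apply: (step s c) => //; last by apply: sgood; rewrite s0 lexx.
    rewrite distrC (distrC (A c)); apply: near_c; last by rewrite s0.
    by rewrite /ball/= ger0_norm ?subr_ge0//; lra.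
  have good_le t : 0 <= t -> t < c -> good t.
    move=> t0 tc; have := @sup_adherent _ E (c - t).
    rewrite subr_gt0 => /(_ tc supE)[s' [_ H] cs'].
    by apply: H; rewrite t0/=; rewrite -/c in cs'; lra.
  have [cltT|Tlec] := ltP c T; last first.
    have -> : T = c by apply/le_anti; rewrite cT Tlec.
    by case: good_c.
  pose c' := Order.min T (c + r / 2).
  have cc' : c < c' by rewrite lt_min cltT/=; lra.
  have Ec' : E c'.
    have c'T : c' <= T by rewrite ge_min lexx.
    split; first by rewrite (le_trans c0 (ltW cc')).
    move=> t /andP[t0 tc']; have [tc|] := ltP t c; first exact: good_le.
    move=> ct; apply: (step c t) => //; first exact: le_trans c'T.
    apply: near_c; last by rewrite t0/= (le_trans tc').
    rewrite /ball/= distrC ger0_norm ?subr_ge0//.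
    have : t <= c + r / 2 by apply: le_trans tc' _; rewrite ge_min lexx orbT.
    by lra.
  have : c' <= c by apply: ub_le_sup => //; exists T.
  by rewrite leNgt cc'.
apply/eqP; rewrite -subr_eq0 -normr_le0.
have AT : 0 <= A T - A 0 by rewrite subr_ge0 Amono// in_itv/= ?lexx ?T0.
apply/ler_addgt0Pl => e e0; rewrite addr0.
have k0 : 0 < A T - A 0 + 1 by lra.
have /domination/le_trans : 0 < e / (A T - A 0 + 1) by rewrite divr_gt0.
apply; rewrite -mulrA ger_pMr// ler_pdivrMl// mulr1; lra.
Qed.

(** * First-order estimates and integrals over intervals *)

Lemma le_norm_sum_coord (R : realType) (d : nat) (v : 'cV[R]_d) :
  `|v| <= \sum_k `|v k 0|.
Proof.
rewrite [`|v|]mx_normrE; apply/bigmax_leP; split; first exact: sumr_ge0.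
move=> [k j] _ /=; rewrite ord1 (bigD1 k)//= lerDl.
by apply: sumr_ge0.
Qed.

Lemma diff_gradient (R : realType) (d : nat) (V : 'cV[R]_d -> R)
    (x v : 'cV[R]_d) : differentiable (V : 'cV[R]_d -> R^o) x ->
  'd (V : 'cV[R]_d -> R^o) x v = \sum_k gradient V x k 0 * v k 0.
Proof.
move=> dV; rewrite {1}[v]matrix_sum_delta linear_sum/=.
apply: eq_bigr => k _; rewrite big_ord1 linearZ/= mxE mulrC; congr (_ * _).
by rewrite deriveE.
Qed.

Lemma coordB (R : realType) (d : nat) (a b : 'cV[R]_d) k :
  (a - b) k 0 = a k 0 - b k 0.
Proof. by rewrite !mxE. Qed.

Lemma first_order_expansion (R : realType) (d : nat) (V : 'cV[R]_d -> R)
    (a : 'cV[R]_d) (e : R) : differentiable (V : 'cV[R]_d -> R^o) a -> 0 < e ->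
  \forall b \near a,
    `|V b - V a - \sum_k gradient V a k 0 * (b k 0 - a k 0)| <= e * `|b - a|.
Proof.
move=> dV e0; have := diffE dV.
move=> /funext/eqaddoP/(_ _ e0); apply: filterS => b /=.
rewrite !fctE/= lim_id; last exact: norm_hausdorff.
rewrite opprD addrA diff_gradient//.
rewrite (eq_bigr (fun k => gradient V a k 0 * (b k 0 - a k 0)))//.
by move=> k _; rewrite coordB.
Qed.

Section interval_integrals.
Context {R : realType}.
Implicit Types (f g c : R -> R) (s t T : R).
Local Notation mu := (@lebesgue_measure R).

Lemma subset_itv0 T t : t <= T -> `[0, t] `<=` `[0, T].
Proof. by move=> tT r /=; rewrite !in_itv/= => /andP[-> /le_trans ->]. Qed.

Lemma integrable_itv0S f T t : t <= T ->
  mu.-integrable `[0, T] (EFin \o f) -> mu.-integrable `[0, t] (EFin \o f).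
Proof. by move=> tT; apply: integrableS => //; exact: subset_itv0. Qed.

Lemma Rintegral_itv0B f s t : 0 <= s -> s <= t ->
  mu.-integrable `[0, t] (EFin \o f) ->
  \int[mu]_(r in `[0, t]) f r - \int[mu]_(r in `[0, s]) f r =
  \int[mu]_(r in `]s, t]) f r.
Proof. by move=> s0 st intf; rewrite Rintegral_itvB// bnd_simp. Qed.

(** The bound is only required between [s] and [t], in either order: it will come
    from continuity at [s], hence hold only near [s]. *)
Lemma le_norm_Rintegral_itv0B f g s t T :
  mu.-integrable `[0, T] (EFin \o f) -> mu.-integrable `[0, T] (EFin \o g) ->
  0 <= s <= T -> 0 <= t <= T ->
  (forall r, 0 <= r <= T -> Order.min s t <= r <= Order.max s t ->
     `|f r| <= g r) ->
  `|\int[mu]_(r in `[0, t]) f r - \int[mu]_(r in `[0, s]) f r| <=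
  `|\int[mu]_(r in `[0, t]) g r - \int[mu]_(r in `[0, s]) g r|.
Proof.
move=> intf intg; wlog st : s t / s <= t => [wlogst s0T t0T fg|].
  have [st|/ltW ts] := leP s t; first exact: wlogst.
  rewrite distrC [leRHS]distrC; apply: wlogst => // r r0T.
  by rewrite minC maxC; exact: fg.
move=> /andP[s0 sT] /andP[t0 tT]; rewrite (min_idPl st) (max_idPr st) => fg.
have intf' := integrable_itv0S tT intf.
have intg' := integrable_itv0S tT intg.
have sub : `]s, t] `<=` `[0, t].
  by move=> r /=; rewrite !in_itv/= => /andP[/ltW/(le_trans s0)-> ->].
have intfst : mu.-integrable `]s, t] (EFin \o f) by apply: integrableS intf'.
have intgst : mu.-integrable `]s, t] (EFin \o g) by apply: integrableS intg'.
rewrite !Rintegral_itv0B//.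
apply: (le_trans (le_normr_Rintegral _ intfst)) => //.
apply: le_trans (ler_norm _).
apply: le_Rintegral => //; [exact: (integrable_norm intfst)|].
move=> r; rewrite /= in_itv/= => /andP[/ltW sr rt]; apply: fg.
  by rewrite (le_trans s0 sr) (le_trans rt).
by rewrite sr.
Qed.

Lemma continuous_itv_integrableM c f T :
  {within `[0, T], continuous c} -> mu.-integrable `[0, T] (EFin \o f) ->
  mu.-integrable `[0, T] (EFin \o (fun t => c t * f t)).
Proof.
move=> cc intf.
have -> : EFin \o (fun t => c t * f t) = ((EFin \o c) \* (EFin \o f))%E.
  by apply/funext => t /=; rewrite EFinM.
apply: integrableMr => //.
  exact: subspace_continuous_measurable_fun.
have /compact_bounded[M [Mreal MB]] :=
  continuous_compact cc (@segment_compact R 0 T).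
by exists M; split => // z Mz t tT; apply: (MB z Mz); exists t.
Qed.

End interval_integrals.

(** * The chain rule along Caratheodory curves *)

Lemma le_coord_norm (R : realType) (d : nat) (v : 'cV[R]_d) k : `|v k 0| <= `|v|.
Proof.
rewrite [`|v|]mx_normrE.
exact: (le_bigmax _ (fun ij : 'I_d * 'I_1 => `|v ij.1 ij.2|) (k, 0)).
Qed.

Lemma continuous_comp_within (R : realType) (A : set R) (X Y : topologicalType)
    (y : R -> X) (g : X -> Y) :
  {within A, continuous y} -> continuous g -> {within A, continuous (g \o y)}.
Proof. by move=> cy cg; apply: within_continuous_comp => // x _; exact: cg. Qed.

(** The increments of [V (y t)] and of the integral of its expected derivative
    are both close to the gradient at [y s] applied to [y t - y s]: the former by
    differentiability of [V] at [y s], the latter because the gradient is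
    continuous along [y].  Both errors are negligible with respect to the
    increment of the arc length of [y], measured with the sum of the absolute
    values of the coordinates. *)
Section chain_rule.
Context {R : realType} {d : nat}.
Variables (V : 'cV[R]_d -> R) (V1 : C1 V).
Variables (x : 'cV[R]_d) (y F : R -> 'cV[R]_d) (T : R).
Hypotheses (T0 : 0 <= T) (intF : integrable_vec `[0, T] F).
Hypothesis cy : {within `[0, T], continuous y}.
Hypothesis yE : forall t, 0 <= t <= T -> y t = x + integral_vec `[0, t] F.
Local Notation mu := (@lebesgue_measure R).

Let p k t := gradient V (y t) k 0.

Let within_continuous_gradient : {within `[0, T], continuous (gradient V \o y)}.
Proof. by apply: continuous_comp_within cy _; case: V1. Qed.

Let integrable_pF k : mu.-integrable `[0, T] (EFin \o (fun t => p k t * F t k 0)).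
Proof.
apply: continuous_itv_integrableM; last exact: intF.
apply: (continuous_comp_within (g := fun v : 'cV[R]_d => v k 0)) within_continuous_gradient _.
exact: coord_continuous.
Qed.

Let integrable_normF k : mu.-integrable `[0, T] (EFin \o (fun t => `|F t k 0|)).
Proof. by apply: integrable_norm; exact: intF. Qed.

Let arc t := \sum_k \int[mu]_(r in `[0, t]) `|F r k 0|.

Let normF_homo k s t : 0 <= s -> s <= t -> t <= T ->
  \int[mu]_(r in `[0, s]) `|F r k 0| <= \int[mu]_(r in `[0, t]) `|F r k 0|.
Proof.
move=> s0 st tT; rewrite -subr_ge0 Rintegral_itv0B//; first exact: Rintegral_ge0.
exact: integrable_itv0S (integrable_normF k).
Qed.

Let arc_homo : {in `[0, T] &, {homo arc : s t / s <= t}}.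
Proof.
move=> s t; rewrite !in_itv/= => /andP[s0 _] /andP[_ tT] st.
by apply: ler_sum => k _; exact: normF_homo.
Qed.

Let arc_sum s t : 0 <= s <= T -> 0 <= t <= T ->
  \sum_k `|\int[mu]_(r in `[0, t]) `|F r k 0| - \int[mu]_(r in `[0, s]) `|F r k 0| | =
  `|arc t - arc s|.
Proof.
wlog st : s t / s <= t => [wlogst s0T t0T|].
  have [st|/ltW ts] := leP s t; first exact: wlogst.
  by rewrite [RHS]distrC -wlogst//; apply: eq_bigr => k _; rewrite distrC.
move=> /[dup] s0T /andP[s0 sT] /[dup] t0T /andP[t0 tT].
have arc_st : arc s <= arc t by apply: arc_homo; rewrite ?in_itv.
rewrite [RHS]ger0_norm ?subr_ge0//.
rewrite /arc -sumrB; apply: eq_bigr => k _.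
by rewrite ger0_norm// subr_ge0 normF_homo.
Qed.

Let displacement k s t : 0 <= s <= T -> 0 <= t <= T ->
  y t k 0 - y s k 0 =
  \int[mu]_(r in `[0, t]) F r k 0 - \int[mu]_(r in `[0, s]) F r k 0.
Proof. by move=> s0T t0T; rewrite !yE// !mxE; ring. Qed.

Let norm_displacement s t : 0 <= s <= T -> 0 <= t <= T ->
  `|y t - y s| <= `|arc t - arc s|.
Proof.
move=> s0T t0T; apply: (le_trans (le_norm_sum_coord _)); rewrite -arc_sum//.
apply: ler_sum => k _; rewrite !mxE displacement//.
by apply: (@le_norm_Rintegral_itv0B _ _ _ _ _ T) => //; exact: intF.
Qed.

(** Freezing the gradient at time [s] costs at most its oscillation between [s]
    and [t], times the length travelled by the coordinate. *)
Let pF_displacement k s t e : 0 <= s <= T -> 0 <= t <= T ->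
  (forall r, 0 <= r <= T -> Order.min s t <= r <= Order.max s t ->
     `|p k s - p k r| <= e) ->
  `|p k s * (y t k 0 - y s k 0) -
    (\int[mu]_(r in `[0, t]) (p k r * F r k 0) -
     \int[mu]_(r in `[0, s]) (p k r * F r k 0))| <=
  e * `|\int[mu]_(r in `[0, t]) `|F r k 0| - \int[mu]_(r in `[0, s]) `|F r k 0| |.
Proof.
move=> s0T t0T ple.
have e0 : 0 <= e.
  apply: le_trans (ple s s0T _) => //.
  by rewrite ge_min lexx le_max lexx.
have intZ (c : R) (f : R -> R) r : r <= T -> mu.-integrable `[0, T] (EFin \o f) ->
    mu.-integrable `[0, r] (EFin \o (fun t => c * f t)).
  move=> rT intf; have := integrableZl _ c (integrable_itv0S rT intf).
  by apply.
have JE r : 0 <= r <= T -> \int[mu]_(z in `[0, r]) (p k s * F z k 0 - p k z * F z k 0) =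
    p k s * \int[mu]_(z in `[0, r]) F z k 0 - \int[mu]_(z in `[0, r]) (p k z * F z k 0).
  move=> /andP[r0 rT]; rewrite RintegralB//.
  - by rewrite RintegralZl//; apply: integrable_itv0S (intF k).
  - exact: (intZ _ _ _ rT (intF k)).
  - exact: (integrable_itv0S rT (integrable_pF k)).
have KE r : 0 <= r <= T -> \int[mu]_(z in `[0, r]) (e * `|F z k 0|) =
    e * \int[mu]_(z in `[0, r]) `|F z k 0|.
  move=> /andP[r0 rT]; rewrite RintegralZl//.
  exact: (integrable_itv0S rT (integrable_normF k)).
rewrite displacement// -[e in leRHS]ger0_norm// -normrM !mulrBr -!KE//.
rewrite (_ : _ - _ - _ =
  \int[mu]_(z in `[0, t]) (p k s * F z k 0 - p k z * F z k 0)
  - \int[mu]_(z in `[0, s]) (p k s * F z k 0 - p k z * F z k 0)); last first.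
  by rewrite !JE//; ring.
apply: (@le_norm_Rintegral_itv0B _ _ _ _ _ T) => //.
- have -> : EFin \o (fun z => p k s * F z k 0 - p k z * F z k 0) =
    ((EFin \o (fun z => p k s * F z k 0)%R) \- (EFin \o (fun z => p k z * F z k 0)%R))%E.
    by apply/funext => z /=; rewrite EFinB.
  by apply: integrableB => //; exact: (intZ _ _ _ (lexx T) (intF k)).
- exact: (intZ _ _ _ (lexx T) (integrable_normF k)).
- by move=> r r0T rst; rewrite -mulrBl normrM ler_wpM2r// ple.
Qed.

Lemma C1_chain_rule :
  mu.-integrable `[0, T] (EFin \o (fun t => \sum_k gradient V (y t) k 0 * F t k 0)) /\
  V (y T) - V (y 0) =
  \int[mu]_(t in `[0, T]) \sum_k gradient V (y t) k 0 * F t k 0.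
Proof.
have sumE : EFin \o (fun t => \sum_k p k t * F t k 0) =
    (fun t => \sum_k (p k t * F t k 0)%:E)%E.
  by apply/funext => t /=; rewrite sumEFin.
split; first by rewrite sumE; apply: integrable_sum => // k _; exact: integrable_pF.
pose G t := V (y t) - \sum_k \int[mu]_(r in `[0, t]) (p k r * F r k 0).
have G0 : G 0 = V (y 0).
  rewrite /G big1 ?subr0// => k _; rewrite set_itv1; exact: Rintegral_set1.
have : G T = G 0.
  apply: (constant_of_small_increments T0 arc_homo) => e e0 s s0T.
  have e20 : 0 < e / 2 by rewrite divr_gt0.
  have sT : `[0, T]%classic s by rewrite /= in_itv.
  have near_V : \forall t \near s, 0 <= t <= T ->
      `|V (y t) - V (y s) - \sum_k p k s * (y t k 0 - y s k 0)| <= e / 2 * `|y t - y s|.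
    have [dV _] := V1.
    have /subspace_continuousP/(_ s sT) ys := cy.
    have : \forall t \near within `[0, T] (nbhs s),
        `|V (y t) - V (y s) - \sum_k p k s * (y t k 0 - y s k 0)| <= e / 2 * `|y t - y s|.
      exact: ys _ (first_order_expansion (dV (y s)) e20).
    by rewrite near_withinE; apply: filterS => t; rewrite /= in_itv.
  have near_p : \forall t \near s, 0 <= t <= T ->
      `|gradient V (y s) - gradient V (y t)| <= e / 2.
    have /subspace_continuousP/(_ s sT)/cvgrPdist_le/(_ _ e20) := within_continuous_gradient.
    by rewrite near_withinE; apply: filterS => t; rewrite /= in_itv.
  have /nbhs_ballP[rho /= rho0 ball_p] := near_p.
  near=> t => t0T.
  have st : ball s rho t by near: t; exact: nbhsx_ballx.
  rewrite -arc_sum//.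
  have -> : G t - G s =
    (V (y t) - V (y s) - \sum_k p k s * (y t k 0 - y s k 0)) +
    \sum_k (p k s * (y t k 0 - y s k 0) -
       (\int[mu]_(r in `[0, t]) (p k r * F r k 0) -
        \int[mu]_(r in `[0, s]) (p k r * F r k 0))).
    by rewrite /G !sumrB; ring.
  apply: (le_trans (ler_normD _ _)).
  rewrite [e in leRHS](splitr e) mulrDl; apply: lerD.
    have nV := near near_V t.
    apply: (le_trans (nV _ t0T)) => //.
    apply: ler_wpM2l; first exact: ltW.
    by rewrite arc_sum//; exact: norm_displacement.
  apply: (le_trans (ler_norm_sum _ _ _)); rewrite mulr_sumr; apply: ler_sum => k _.
  apply: pF_displacement => // r r0T rst.
  rewrite -coordB; apply: (le_trans (le_coord_norm _ _)); apply: ball_p => //.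
  move: st rst; rewrite /ball/= !ltr_distl.
  by have [_|_] := leP s t; move=> /andP[? ?] /andP[? ?]; apply/andP; split; lra.
rewrite G0 /G => <-; rewrite subKr.
transitivity (fine (\int[mu]_(t in `[0%R, T]) \sum_k (p k t * F t k 0)%:E)%E).
  rewrite integral_sum//=.
  rewrite (eq_bigr (fun k => (\int[mu]_(t in `[0, T]) (p k t * F t k 0))%:E)) ?sumEFin//.
  move=> k _; rewrite /Rintegral fineK//.
  by apply: integrable_fin_num => //; exact: integrable_pF.
by congr fine; apply: eq_integral => t _; rewrite sumEFin.
Unshelve. all: by end_near.
Qed.

End chain_rule.

(** * Translation invariance of the Lebesgue integral *)

Section translation.
Context {R : realType}.
Implicit Types (D A : set R) (T : R).
Local Notation mu := (@lebesgue_measure R).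

Let center_measurable T : measurable_fun [set: R] (center T : R -> R).
Proof.
apply: continuous_measurable_fun => s.
by apply: cvgB; [exact: cvg_id|exact: cvg_cst].
Qed.

(** A measure on the line is determined by its values on half-open intervals,
    whose lengths are translation invariant. *)
Lemma lebesgue_measure_center T A : measurable A ->
  pushforward mu (center T : _ -> measurableTypeR R) A = mu A.
Proof.
move=> mA; apply/esym/lebesgue_measure_unique => //=.
  exact: center_measurable.
move=> _ _ [[a b]] _ <-.
rewrite /pushforward (_ : _ @^-1` _ = `]a + T, b + T]%classic); last first.
  by apply/seteqP; split=> s /=; rewrite !in_itv/= ltrBrDr lerBlDr.
rewrite !lebesgue_measure_itv/= !lte_fin ltrD2r.
by case: ifPn => // _; rewrite -!EFinB; congr EFin; ring.
Qed.

Lemma measurable_fun_center d' (Y : sigmaRingType d') T D (f : R -> Y) : measurable D ->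
  measurable_fun D f -> measurable_fun (center T @^-1` D) (f \o center T).
Proof.
move=> mD mf; apply: (measurable_comp mD) => //.
  by move=> _ [s Ds <-].
exact: measurable_funTS.
Qed.

Lemma ge0_integral_center T D (f : R -> \bar R) : measurable D ->
  measurable_fun D f -> (forall s, D s -> (0 <= f s)%E) ->
  (\int[mu]_(s in center T @^-1` D) f (s - T)%R = \int[mu]_(s in D) f s)%E.
Proof.
move=> mD mf f0.
transitivity (\int[pushforward mu (center T : _ -> measurableTypeR R)]_(s in D) f s)%E.
  rewrite ge0_integral_pushforward//=.
    exact: center_measurable.
  by move=> s; rewrite inE; exact: f0.
apply: eq_measure_integral => //= [|? A mA AD]; first exact: center_measurable.
exact: lebesgue_measure_center.
Qed.

Lemma integral_center T D (f : R -> \bar R) : measurable D -> measurable_fun D f ->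
  (\int[mu]_(s in center T @^-1` D) f (s - T)%R = \int[mu]_(s in D) f s)%E.
Proof.
move=> mD mf; rewrite integralE [RHS]integralE; congr (_ - _)%E.
- rewrite -[RHS](@ge0_integral_center T)//; last exact: measurable_funepos.
  by apply: eq_integral => s _; rewrite -[RHS]/((f^\+%E \o center T) s) -funepos_comp.
- rewrite -[RHS](@ge0_integral_center T)//; last exact: measurable_funeneg.
  by apply: eq_integral => s _; rewrite -[RHS]/((f^\-%E \o center T) s) -funeneg_comp.
Qed.

Lemma integrable_center T D (f : R -> \bar R) : measurable D ->
  mu.-integrable D f -> mu.-integrable (center T @^-1` D) (f \o center T).
Proof.
move=> mD /integrableP[mf intf]; apply/integrableP; split.
  exact: measurable_fun_center.
rewrite /= (@ge0_integral_center T D (fun s => `|f s|%E))//.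
exact: measurableT_comp.
Qed.

Lemma center_itv_oc T a b : center T @^-1` `]a, b] = `]a + T, b + T]%classic.
Proof. by apply/seteqP; split=> s /=; rewrite !in_itv/= ltrBrDr lerBlDr. Qed.

Lemma center_itv_oy T a : center T @^-1` `]a, +oo[ = `]a + T, +oo[%classic.
Proof. by apply/seteqP; split=> s /=; rewrite !in_itv/= !andbT ltrBrDr. Qed.

End translation.

(** * Concatenation of curves *)

Definition concat (R : realType) (X : Type) (T : R) (a b : R -> X) (t : R) : X :=
  if t <= T then a t else b (t - T).

Section concatenation.
Context {R : realType}.
Implicit Types (t T : R).
Local Notation mu := (@lebesgue_measure R).

Lemma concat_le (X : Type) T (a b : R -> X) t : t <= T -> concat T a b t = a t.
Proof. by rewrite /concat => ->. Qed.

Lemma concat_gt (X : Type) T (a b : R -> X) t : T < t -> concat T a b t = b (t - T).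
Proof. by rewrite /concat ltNge => /negbTE ->. Qed.

(** If the curves match at the junction, the second branch is also valid at time
    [T] itself; this makes both branches available on closed intervals. *)
Lemma concat_ge (X : Type) T (a b : R -> X) t : b 0 = a T -> T <= t ->
  concat T a b t = b (t - T).
Proof.
rewrite le_eqVlt => ba /predU1P[<-|]; last exact: concat_gt.
by rewrite concat_le// subrr.
Qed.

Lemma comp_concat (X Y : Type) T (g : X -> Y) (a b : R -> X) :
  g \o concat T a b = concat T (g \o a) (g \o b).
Proof. by apply/funext => t; rewrite /concat/=; case: ifP. Qed.

Lemma itv0y_setU T : 0 <= T -> `[0%R, +oo[%classic = `[0, T] `|` `]T, +oo[.
Proof. by move=> T0; rewrite -itv_bndbnd_setU// bnd_simp. Qed.

Lemma itv0_setU T t : 0 <= T -> T <= t -> `[0, t]%classic = `[0, T] `|` `]T, t].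
Proof. by move=> T0 Tt; rewrite -itv_bndbnd_setU// bnd_simp. Qed.

Lemma measurable_concat d (Y : sigmaRingType d) T (a b : R -> Y) : 0 <= T ->
  measurable_fun (`[0, +oo[ : set R) a -> measurable_fun (`[0, +oo[ : set R) b ->
  measurable_fun (`[0, +oo[ : set R) (concat T a b).
Proof.
move=> T0 ma mb; rewrite (itv0y_setU T0); apply/measurable_funU => //; split.
  apply: (@eq_measurable_fun _ _ _ _ _ a) => [t|].
    by rewrite inE/= in_itv/= => /andP[_ tT]; rewrite concat_le.
  by apply: measurable_funS ma => // s; rewrite /= !in_itv/= => /andP[->].
apply: (@eq_measurable_fun _ _ _ _ _ (b \o center T)) => [t|].
  by rewrite inE/= in_itv/= andbT => Tt; rewrite concat_gt.
rewrite -{1}[T]add0r -center_itv_oy; apply: measurable_fun_center => //.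
apply: measurable_funS mb => // s; rewrite /= !in_itv/= !andbT; exact: ltW.
Qed.

Lemma within_continuous_concat (X : topologicalType) T (a b : R -> X) : 0 <= T ->
  b 0 = a T ->
  {within (`[0, +oo[ : set R), continuous a} -> {within (`[0, +oo[ : set R), continuous b} ->
  {within (`[0, +oo[ : set R), continuous (concat T a b)}.
Proof.
move=> T0 ba ca cb.
have -> : `[0%R, +oo[%classic = `[0, T] `|` `[T, +oo[.
  apply/seteqP; split=> s /=; rewrite !in_itv/= !andbT.
    by move=> s0; have [sT|/ltW Ts] := leP s T; [left; rewrite s0|right].
  by move=> [/andP[]//|]; exact: le_trans.
apply: withinU_continuous; [exact: itv_closed|exact: rray_closed| |].
  apply: (@subspace_eq_continuous _ _ _ a (concat T a b)) => [t|].
    by rewrite inE/= in_itv/= => /andP[_ tT]; rewrite concat_le.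
  by apply: continuous_subspaceW ca => s; rewrite /= !in_itv/= => /andP[->].
apply: (@subspace_eq_continuous _ _ _ (b \o center T) (concat T a b)) => [t|].
  by rewrite inE/= in_itv/= andbT => Tt; rewrite concat_ge.
apply/subspace_continuousP => t /=; rewrite in_itv/= andbT => Tt.
move/subspace_continuousP : cb => /(_ (t - T)).
rewrite /= in_itv/= andbT subr_ge0 => /(_ Tt) cb.
have center_cvg : center T s @[s --> t] --> t - T.
  by apply: cvgB; [exact: cvg_id|exact: cvg_cst].
apply: (@cvg_comp _ _ _ (center T) b _ _ _ _ cb) => A nA.
have : \forall s \near t, `[0, +oo[%classic (s - T) -> A (s - T) by exact: center_cvg nA.
move=> nA0; suff : \forall s \near t, `[T, +oo[%classic s -> A (s - T) by [].
apply: filterS nA0 => s As /=; rewrite in_itv/= andbT => Ts; apply: As.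
by rewrite /= in_itv/= andbT subr_ge0.
Qed.

Lemma integrable_setU (A B : set R) (f : R -> \bar R) :
  measurable A -> measurable B -> [disjoint A & B] ->
  mu.-integrable A f -> mu.-integrable B f -> mu.-integrable (A `|` B) f.
Proof.
move=> mA mB AB /integrableP[mfA fA] /integrableP[mfB fB].
have mf : measurable_fun (A `|` B) f by exact/measurable_funU.
apply/integrableP; split => //; rewrite ge0_integral_setU//; first exact: lte_add_pinfty.
exact: measurableT_comp.
Qed.

Lemma disjoint_itv0 T b : [disjoint `[0, T]%classic & [set` Interval (BRight T) b] ].
Proof.
rewrite disj_set2E; apply/eqP/seteqP; split=> t //=; rewrite !in_itv/=.
by move=> [/andP[_ tT] /andP[/(le_lt_trans tT)]]; rewrite ltxx.
Qed.

Lemma integrable_concat T (a b : R -> R) t : 0 <= T -> T <= t ->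
  mu.-integrable `[0, T] (EFin \o a) -> mu.-integrable `[0, t - T] (EFin \o b) ->
  mu.-integrable `[0, t] (EFin \o concat T a b) /\
  \int[mu]_(r in `[0, t]) concat T a b r =
  \int[mu]_(r in `[0, T]) a r + \int[mu]_(r in `[0, t - T]) b r.
Proof.
move=> T0 Tt inta intb.
have intb' : mu.-integrable `]0, t - T] (EFin \o b).
  by apply: integrableS intb => // s; rewrite /= !in_itv/= => /andP[/ltW-> ->].
have centerE : center T @^-1` `]0, t - T] = `]T, t]%classic.
  by rewrite center_itv_oc add0r subrK.
have on_left : {in `[0, T]%classic, EFin \o a =1 EFin \o concat T a b}.
  by move=> r; rewrite inE/= in_itv/= => /andP[_ rT]; rewrite concat_le.
have on_right : {in `]T, t]%classic,
    (EFin \o b) \o center T =1 EFin \o concat T a b}.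
  by move=> r; rewrite inE/= in_itv/= => /andP[Tr _]; rewrite concat_gt.
have int_left : mu.-integrable `[0, T] (EFin \o concat T a b).
  exact: (@eq_integrable _ _ _ mu _ _ _ _ on_left inta).
have int_right : mu.-integrable `]T, t] (EFin \o concat T a b).
  apply: (@eq_integrable _ _ _ mu _ _ _ _ on_right) => //.
  by rewrite -centerE; apply: integrable_center.
have int_all : mu.-integrable `[0, t] (EFin \o concat T a b).
  by rewrite (itv0_setU T0 Tt); apply: integrable_setU => //; exact: disjoint_itv0.
split=> //; rewrite [in LHS](itv0_setU T0 Tt) Rintegral_setU//; last 2 first.
  by rewrite -itv0_setU.
  exact: disjoint_itv0.
congr (_ + _); first by congr fine; apply: eq_integral => r rT; exact/esym/on_left.
rewrite -Rintegral_itv_obnd_cbnd// /Rintegral; congr fine.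
rewrite -[RHS](@integral_center _ T _ (EFin \o b))//; last by move: intb' => /integrableP[].
by rewrite centerE; apply: eq_integral => r rT; exact/esym/on_right.
Qed.

End concatenation.

(** * Weighted quadratic forms *)

Section quadratic_forms.
Context {R : realType} {n : nat}.
Implicit Types (A : 'M[R]_n) (v w : 'cV[R]_n).

Lemma wnorm2_ge0 A v : posdef A -> 0 <= wnorm2 A v.
Proof.
move=> [_ A_gt0]; have [->|/A_gt0/ltW//] := eqVneq v 0.
by rewrite /wnorm2 mulmx0 mxE.
Qed.

Lemma wnorm20 A : wnorm2 A 0 = 0.
Proof. by rewrite /wnorm2 mulmx0 mxE. Qed.

Lemma mx_form_sym A v w : A^T = A -> (v^T *m A *m w) 0 0 = (w^T *m A *m v) 0 0.
Proof.
move=> symA; have -> : v^T *m A *m w = (w^T *m A *m v)^T.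
  by rewrite !trmx_mul trmxK symA mulmxA.
by rewrite mxE.
Qed.

Lemma wnorm2B A v w : A^T = A ->
  wnorm2 A (v - w) = wnorm2 A v - 2 * (w^T *m A *m v) 0 0 + wnorm2 A w.
Proof.
move=> symA; rewrite /wnorm2 [(v - w)^T]raddfB/= !mulmxBl !mulmxBr !coordB.
by rewrite [(v^T *m A *m w) 0 0]mx_form_sym//; ring.
Qed.

(** A row in the left kernel of [A] has zero [A]-norm. *)
Lemma posdef_unitmx A : posdef A -> A \in unitmx.
Proof.
move=> [_ A_gt0]; rewrite -row_free_unit -kermx_eq0; apply/eqP/row_matrixP => i.
rewrite row0; apply/eqP; apply: contraT => /negP v_neq0.
have kerA : row i (kermx A) *m A = 0 by rewrite -row_mul mulmx_ker row0.
have := A_gt0 (row i (kermx A))^T.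
rewrite /wnorm2 trmxK kerA mul0mx mxE ltxx => H; apply/H.
by apply: contra_notN v_neq0 => /eqP vT0; rewrite -[row _ _]trmxK vT0 trmx0.
Qed.

End quadratic_forms.

(** * Trajectories of the controlled system *)

(** The vector [wn] is the critical point in [v] of
    [p^T h v - gam^2 |v|_P^2], so that this concave quadratic function differs
    from its maximum by [- gam^2 |v - wn|_P^2].  Subtracting its value at the [w]
    for which the equation holds leaves the two squares. *)
Lemma completed_square (R : realType) (d q : nat) (P : 'M[R]_q) (gam c : R)
    (p a : 'cV[R]_d) (h : 'M[R]_(d, q)) (w v wn : 'cV[R]_q) :
  posdef P -> gam != 0 ->
  wn = (2 * gam ^+ 2)^-1 *: (invmx P *m h^T *m p) ->
  (p^T *m (a + h *m w)) 0 0 + c - gam ^+ 2 * wnorm2 P w = 0 ->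
  (p^T *m (a + h *m v)) 0 0 =
    - (c - gam ^+ 2 * wnorm2 P v)
    - gam ^+ 2 * wnorm2 P (v - wn) + gam ^+ 2 * wnorm2 P (wn - w).
Proof.
move=> P_pos gam0 wnE.
have [symP _] := P_pos.
have g0 : 2 * gam ^+ 2 != 0 by rewrite mulf_neq0 ?expf_neq0 ?pnatr_eq0.
have PwnE : h^T *m p = (2 * gam ^+ 2) *: (P *m wn).
  rewrite wnE -scalemxAr scalerA mulfV// scale1r mulmxA mulKVmx ?mulmxA//.
  exact: posdef_unitmx.
have phE z : (p^T *m (h *m z)) 0 0 = 2 * gam ^+ 2 * (wn^T *m P *m z) 0 0.
  have -> : p^T *m (h *m z) = (h^T *m p)^T *m z by rewrite trmx_mul trmxK mulmxA.
  by rewrite PwnE linearZ/= trmx_mul symP -scalemxAl mxE.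
have splitE z : (p^T *m (a + h *m z)) 0 0 =
    (p^T *m a) 0 0 + 2 * gam ^+ 2 * (wn^T *m P *m z) 0 0.
  by rewrite mulmxDr mxE phE.
rewrite !splitE !wnorm2B// (mx_form_sym w)// => pde.
by apply/eqP; rewrite -subr_eq0; apply/eqP; move: pde; lra.
Qed.

Lemma mx_dotE (R : realType) (d : nat) (p v : 'cV[R]_d) :
  (p^T *m v) 0 0 = \sum_k p k 0 * v k 0.
Proof. by rewrite mxE; apply: eq_bigr => k _; rewrite mxE. Qed.

Section trajectories.
Context {R : realType} {d m q : nat}.
Variable S : game R d m q.
Implicit Types (x : 'cV[R]_d) (y : R -> 'cV[R]_d)
  (u : R -> 'cV[R]_m) (w : R -> 'cV[R]_q) (T : R).
Local Notation mu := (@lebesgue_measure R).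
Local Notation halfline := (`[0%R, +oo[%classic : set R).

Definition velocity u w y t : 'cV[R]_d :=
  fdyn S (y t) + gdyn S (y t) *m u t + hdyn S (y t) *m w t.

Lemma trajectory_start x u w y : trajectory S halfline x u w y -> y 0 = x.
Proof.
move=> [_ _ _ /(_ 0)[|_ ->]]; first by rewrite /= in_itv/= lexx.
rewrite (_ : integral_vec _ _ = 0) ?addr0//; apply/matrixP => k j.
by rewrite !mxE set_itv1 Rintegral_set1.
Qed.

Lemma trajectory_chain_rule (V : 'cV[R]_d -> R) x u w y T :
  C1 V -> trajectory S halfline x u w y -> 0 <= T ->
  mu.-integrable `[0, T]
    (EFin \o (fun t => ((gradient V (y t))^T *m velocity u w y t) 0 0)) /\
  V (y T) - V x =
    \int[mu]_(t in `[0, T]) ((gradient V (y t))^T *m velocity u w y t) 0 0.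
Proof.
move=> V1 traj T0; rewrite -(trajectory_start traj).
have -> : (fun t => ((gradient V (y t))^T *m velocity u w y t) 0 0) =
    (fun t => \sum_k gradient V (y t) k 0 * velocity u w y t k 0).
  by apply/funext => t; rewrite mx_dotE.
have [_ _ cy yE] := traj.
apply: (@C1_chain_rule _ _ V V1 x) => //.
- by have [|] := yE T; first by rewrite /= in_itv/= T0.
- by apply: continuous_subspaceW cy => t; rewrite /= !in_itv/= => /andP[->].
- by move=> t /andP[t0 _]; have [|_ ->//] := yE t; rewrite /= in_itv/= t0.
Qed.

Lemma velocity_concat T u1 u2 w1 w2 y1 y2 :
  velocity (concat T u1 u2) (concat T w1 w2) (concat T y1 y2) =
  concat T (velocity u1 w1 y1) (velocity u2 w2 y2).
Proof. by apply/funext => t; rewrite /velocity /concat; case: ifP. Qed.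

Lemma measurable_vec_concat n T (a b : R -> 'cV[R]_n) : 0 <= T ->
  measurable_vec halfline a -> measurable_vec halfline b ->
  measurable_vec halfline (concat T a b).
Proof.
move=> T0 ma mb k.
have -> : (fun t => concat T a b t k 0) =
    concat T (fun t => a t k 0) (fun t => b t k 0).
  exact: (comp_concat T (fun v : 'cV[R]_n => v k 0)).
by apply: measurable_concat; [|exact: ma|exact: mb].
Qed.

(** The system is autonomous, so a solution issued from [y1 T] can be started at
    time [T]; the integral equation after [T] follows from translation
    invariance. *)
Lemma trajectory_concat T x u1 w1 y1 u2 w2 y2 : 0 <= T ->
  trajectory S halfline x u1 w1 y1 ->
  trajectory S halfline (y1 T) u2 w2 y2 ->
  trajectory S halfline x (concat T u1 u2) (concat T w1 w2) (concat T y1 y2).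
Proof.
move=> T0 traj1 traj2; have y2_0 := trajectory_start traj2.
have [mu1 mw1 cy1 yE1] := traj1; have [mu2 mw2 cy2 yE2] := traj2.
split.
- exact: measurable_vec_concat.
- exact: measurable_vec_concat.
- exact: within_continuous_concat.
rewrite -/(velocity _ _ _) velocity_concat => t.
rewrite /= in_itv/= andbT => t0.
have at0 s : 0 <= s -> halfline s by move=> s0; rewrite /= in_itv/= s0.
have entryE k : (fun r => concat T (velocity u1 w1 y1) (velocity u2 w2 y2) r k 0) =
    concat T (fun r => velocity u1 w1 y1 r k 0) (fun r => velocity u2 w2 y2 r k 0).
  exact: (comp_concat T (fun v : 'cV[R]_d => v k 0)).
have [tT|/ltW Tt] := leP t T.
  have [int1 yE1t] := yE1 t (at0 _ t0).
  have same k : {in `[0, t]%classic, (fun r => velocity u1 w1 y1 r k 0) =1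
      concat T (fun r => velocity u1 w1 y1 r k 0) (fun r => velocity u2 w2 y2 r k 0)}.
    by move=> r; rewrite inE/= in_itv/= => /andP[_ rt]; rewrite concat_le// (le_trans rt).
  split=> [k|].
    rewrite (_ : (fun t => _) = EFin \o
      concat T (fun r => velocity u1 w1 y1 r k 0) (fun r => velocity u2 w2 y2 r k 0)); last first.
      by rewrite -entryE.
    apply: (@eq_integrable _ _ _ mu _ _ _ _ _ (int1 k)) => // r rt /=.
    by rewrite -same.
  rewrite concat_le// yE1t; congr (_ + _); apply/matrixP => k j.
  rewrite !mxE entryE; congr fine; apply: eq_integral => r rt.
  by rewrite -same.
have [int1 yE1T] := yE1 T (at0 _ T0).
have [|int2 yE2t] := yE2 (t - T); first by apply: at0; rewrite subr_ge0.
have int_concat k := integrable_concat T0 Tt (int1 k) (int2 k).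
split=> [k|].
  rewrite (_ : (fun t => _) = EFin \o
    concat T (fun r => velocity u1 w1 y1 r k 0) (fun r => velocity u2 w2 y2 r k 0)); last first.
    by rewrite -entryE.
  by have [] := int_concat k.
rewrite concat_ge// yE2t yE1T -addrA; congr (_ + _); apply/matrixP => k j.
by rewrite !mxE entryE; have [_ ->] := int_concat k.
Qed.

End trajectories.

(** * Continuity and measurability of matrix expressions *)

Lemma lipschitz_continuous (R : realType) (V W : normedModType R) (f : V -> W) :
  (exists k : R, k.-lipschitz f) -> continuous f.
Proof.
move=> [k kf] x; apply/cvgrPdist_lt => e e0.
have k0 : 0 < `|k| + 1 by rewrite ltr_wpDl.
have : \forall z \near x, `|x - z| < e / (`|k| + 1).
  by apply: cvgr_dist_lt; [exact: cvg_id|rewrite divr_gt0].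
apply: filterS => z; rewrite ltr_pdivlMr// => xz.
have /= := kf (x, z) (conj I I); move/le_lt_trans; apply.
apply: le_lt_trans xz; rewrite mulrC ler_wpM2l//.
by apply: (le_trans (ler_norm k)); rewrite lerDl.
Qed.

Lemma continuous_mulmx (R : realType) (X : topologicalType) a b c
    (M : X -> 'M[R]_(a, b)) (N : X -> 'M[R]_(b, c)) :
  (forall i j, continuous (fun x => M x i j)) ->
  (forall i j, continuous (fun x => N x i j)) ->
  forall i j, continuous (fun x => (M x *m N x) i j).
Proof.
move=> cM cN i j; rewrite (_ : (fun x => _) = fun x => \sum_k M x i k * N x k j).
  by apply: (@continuous_big) => [|k _ x]; [exact: add_continuous|apply: cvgM; [exact: cM|exact: cN]].
by apply/funext => x; rewrite mxE.
Qed.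

Lemma measurable_mulmx (R : realType) (D : set R) a b c
    (M : R -> 'M[R]_(a, b)) (N : R -> 'M[R]_(b, c)) :
  (forall i j, measurable_fun D (fun t => M t i j)) ->
  (forall i j, measurable_fun D (fun t => N t i j)) ->
  forall i j, measurable_fun D (fun t => (M t *m N t) i j).
Proof.
move=> mM mN i j; rewrite (_ : (fun t => _) = fun t => \sum_k M t i k * N t k j).
  by apply: measurable_sum => k; apply: measurable_funM; [exact: mM|exact: mN].
by apply/funext => x; rewrite mxE.
Qed.

Lemma measurable_wnorm2 (R : realType) (D : set R) n (A : 'M[R]_n) (v : R -> 'cV[R]_n) :
  measurable_vec D v -> measurable_fun D (fun t => wnorm2 A (v t)).
Proof.
move=> mv; apply: measurable_mulmx => i j; last by rewrite ord1; exact: mv.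
apply: measurable_mulmx => k l; last exact: measurable_cst.
by under eq_fun do rewrite mxE; rewrite ord1; exact: mv.
Qed.

Lemma within_continuous_measurable_comp (R : realType) d a b (D : set R) (y : R -> 'cV[R]_d)
    (g : 'cV[R]_d -> 'M[R]_(a, b)) i j : measurable D ->
  {within D, continuous y} -> continuous g ->
  measurable_fun D (fun t => g (y t) i j).
Proof.
move=> mD cy cg; apply: subspace_continuous_measurable_fun => //.
apply: (@continuous_comp_within _ _ _ _ (g \o y) (fun A : 'M[R]_(a, b) => A i j)).
  exact: (@continuous_comp_within _ _ _ _ y g cy cg).
exact: coord_continuous.
Qed.

(** * The inner loop of policy iteration *)

Lemma Rintegral_itv_gt0 (R : realType) (f : R -> R) (T : R) : 0 < T ->
  lebesgue_measure.-integrable `[0, T] (EFin \o f) ->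
  (forall t, 0 <= t <= T -> 0 < f t) ->
  0 < \int[lebesgue_measure]_(t in `[0, T]) f t.
Proof.
move=> T0 intf f0.
have fpos t : `[0, T]%classic t -> 0 < f t by rewrite /= in_itv; exact: f0.
rewrite lt_neqAle Rintegral_ge0 ?andbT; last by move=> t /fpos/ltW.
apply/negP => /eqP int0.
have mf : measurable_fun (`[0, T]%classic : set R) (EFin \o f).
  by case/integrableP : intf.
have abs0 : (\int[lebesgue_measure]_(t in `[0%R, T]) `|(EFin \o f) t| = 0)%E.
  transitivity (\int[lebesgue_measure]_(t in `[0%R, T]) (f t)%:E)%E.
    by apply: eq_integral => t; rewrite inE => /fpos/ltW ft; rewrite /= ger0_norm.
  rewrite -[LHS]fineK; first by congr EFin; exact/esym/int0.
  exact: integrable_fin_num.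
have ae0 : ae_eq lebesgue_measure (`[0, T]%classic : set R) (EFin \o f) (cst 0%E).
  by apply/ae_eq_integral_abs.
have neg : lebesgue_measure.-negligible (`[0, T]%classic : set R).
  apply: negligibleS ae0 => t tT /= /(_ tT) [] ft0.
  by have := fpos _ tT; rewrite ft0 ltxx.
have /eqP : lebesgue_measure (`[0, T]%classic : set R) = 0%E by apply/negligibleP.
by rewrite lebesgue_measure_itv/= lte_fin T0 oppr0 adde0 eqe gt_eqF.
Qed.

(** One step of the outer loop: the policy [uf] is held fixed while the disturbance
    feedback is improved. *)
Section policy_evaluation.
Context {R : realType} {d m q : nat}.
Variable S : game R d m q.
Hypothesis hS : game_assumptions S.
Variables (Omega : set 'cV[R]_d) (gam : R).
Hypotheses (Omega0 : interior Omega 0) (gam_gt0 : 0 < gam).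
Variables (uf : 'cV[R]_d -> 'cV[R]_m) (w : nat -> 'cV[R]_d -> 'cV[R]_q)
  (V : nat -> 'cV[R]_d -> R).
Hypothesis w0 : forall x, w 0%N x = 0.
Hypothesis pde : forall j x,
  ((gradient (V j) x)^T *m
    (fdyn S x + gdyn S x *m uf x + hdyn S x *m w j x)) 0 0
  + ell S x + wnorm2 (Rmat S) (uf x)
  - gam ^+ 2 * wnorm2 (Pmat S) (w j x) = 0.
Hypothesis V_0 : forall j, V j 0 = 0.
Hypothesis wS : forall j x, w j.+1 x =
  (2 * gam ^+ 2)^-1 *: (invmx (Pmat S) *m (hdyn S x)^T *m gradient (V j) x).
Hypothesis V_C1 : forall j, C1 (V j).
Hypothesis stable : forall j,
  asymptotically_stable (closed_loop S uf (w j)) Omega.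

Local Notation mu := (@lebesgue_measure R).
Local Notation halfline := (`[0%R, +oo[%classic : set R).
Implicit Types (x : 'cV[R]_d) (v : 'cV[R]_q) (y : R -> 'cV[R]_d) (T : R).

Definition stage_cost x v : R :=
  ell S x + wnorm2 (Rmat S) (uf x) - gam ^+ 2 * wnorm2 (Pmat S) v.

(** Derivative of [V j] along the system driven by [uf] and [v]. *)
Definition lie_derivative j x v : R := ((gradient (V j) x)^T *m
  (fdyn S x + gdyn S x *m uf x + hdyn S x *m v)) 0 0.

Lemma lie_derivative_own j x : lie_derivative j x (w j x) = - stage_cost x (w j x).
Proof. by have := pde j x; rewrite /lie_derivative /stage_cost; lra. Qed.

Lemma lie_derivativeE j x v : lie_derivative j x v = - stage_cost x v
  - gam ^+ 2 * wnorm2 (Pmat S) (v - w j.+1 x)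
  + gam ^+ 2 * wnorm2 (Pmat S) (w j.+1 x - w j x).
Proof.
apply: completed_square (wS j x) _; [exact: P_posdef hS|by rewrite gt_eqF|].
by rewrite addrA pde.
Qed.

Lemma ell_ge0 x : 0 <= ell S x.
Proof.
have [->|/(ell_gt0 hS)/ltW//] := eqVneq x 0.
by rewrite (ell_eq0 hS).
Qed.

Lemma stage_cost0_ge x : ell S x <= stage_cost x 0.
Proof.
by rewrite /stage_cost wnorm20 mulr0 subr0 lerDl wnorm2_ge0//; exact: R_posdef hS.
Qed.

Lemma evaluation_along_trajectory j k x y T :
  closed_loop S uf (w k) x y -> 0 <= T ->
  mu.-integrable `[0, T] (EFin \o (fun t => lie_derivative j (y t) (w k (y t)))) /\
  V j (y T) - V j x = \int[mu]_(t in `[0, T]) lie_derivative j (y t) (w k (y t)).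
Proof. by move=> cl; exact: trajectory_chain_rule. Qed.

Lemma stage_cost_along_trajectory j x y T :
  closed_loop S uf (w j) x y -> 0 <= T ->
  mu.-integrable `[0, T] (EFin \o (fun t => stage_cost (y t) (w j (y t)))) /\
  \int[mu]_(t in `[0, T]) stage_cost (y t) (w j (y t)) = V j x - V j (y T).
Proof.
move=> cl T0; have [intd E] := evaluation_along_trajectory j cl T0.
have intc : mu.-integrable `[0, T] (EFin \o (fun t => stage_cost (y t) (w j (y t)))).
  have := integrableN intd; congr (integrable _ _ _); apply/funext => t /=.
  by rewrite lie_derivative_own opprK.
split=> //; apply/eqP; rewrite -eqr_opp opprB E -mulN1r -RintegralZl//; apply/eqP.
by apply: eq_Rintegral => t _; rewrite lie_derivative_own mulN1r.
Qed.

Lemma evaluation_cvg0 j k x y : Omega x -> closed_loop S uf (w k) x y ->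
  V j (y t) @[t --> +oo] --> 0.
Proof.
move=> Ox cl; have [_ /(_ y cl) y0] := as_attractive (stable k) Ox.
have [dV _] := V_C1 j.
have V0 : V j z @[z --> (0 : 'cV[R]_d)] --> V j 0 by exact: differentiable_continuous (dV 0).
by rewrite -(V_0 j); exact: cvg_comp y0 V0.
Qed.

(** Along the trajectory of [w j.+1], the derivative of [V j.+1 - V j] is
    [- gam^2 |w j.+1 - w j|^2], and the difference vanishes at infinity. *)
Lemma evaluation_monotone j x : Omega x -> V j x <= V j.+1 x.
Proof.
move=> Ox; have [[y cl] _] := as_attractive (stable j.+1) Ox.
have swap (a b c e : R) : a - b <= c - e -> a - c <= b - e by lra.
rewrite -subr_ge0.
have V0 : V j.+1 (y t) - V j (y t) @[t --> +oo] --> 0.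
  by rewrite -(subr0 0); apply: cvgB; exact: evaluation_cvg0 Ox cl.
apply: (cvgr_to_le V0); near=> T.
have T0 : 0 <= T by near: T; exact: nbhs_pinfty_ge.
have [int0 E0] := evaluation_along_trajectory j cl T0.
have [int1 E1] := evaluation_along_trajectory j.+1 cl T0.
apply: swap; rewrite E0 E1; apply: le_Rintegral => // t _.
rewrite lie_derivative_own lie_derivativeE subrr wnorm20 mulr0 subr0 lerDl mulr_ge0 ?sqr_ge0//.
by apply: wnorm2_ge0; exact: P_posdef hS.
Unshelve. all: by end_near.
Qed.

(** Equality would hold with the integral up to infinity; as the running cost is
    nonnegative for [w 0 = 0], truncating the integral gives a lower bound. *)
Lemma evaluation0_ge_cost x y T : Omega x -> closed_loop S uf (w 0%N) x y -> 0 <= T ->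
  \int[mu]_(t in `[0, T]) stage_cost (y t) (w 0%N (y t)) <= V 0%N x.
Proof.
move=> Ox cl T0.
have : V 0%N x - V 0%N (y t) @[t --> +oo] --> V 0%N x.
  by rewrite -[X in _ --> X]subr0; apply: cvgB; [exact: cvg_cst|exact: evaluation_cvg0 Ox cl].
move=> /cvgr_to_ge; apply; near=> T'.
have TT' : T <= T' by near: T'; apply: nbhs_pinfty_ge; exact: num_real.
have T'0 := le_trans T0 TT'.
have [intc <-] := stage_cost_along_trajectory cl T'0.
rewrite -subr_ge0 Rintegral_itv0B//; apply: Rintegral_ge0 => t _.
by rewrite w0; exact: le_trans (ell_ge0 _) (stage_cost0_ge _).
Unshelve. all: by end_near.
Qed.

(** By continuity the trajectory stays away from 0 for some time, during which the
    running cost is positive. *)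
Lemma evaluation0_gt0 x : Omega x -> x != 0 -> 0 < V 0%N x.
Proof.
move=> Ox x0; have [[y cl] _] := as_attractive (stable 0%N) Ox.
have y0 := trajectory_start cl; have [_ _ cy _] := cl.
have [T T0 yT] : exists2 T, 0 < T & forall t, 0 <= t <= T -> y t != 0.
  have h0 : halfline 0 by rewrite /= in_itv/= lexx.
  move/subspace_continuousP : cy => /(_ 0 h0) /cvgrPdist_lt /(_ `|x|).
  rewrite normr_gt0 => /(_ x0); rewrite near_withinE => /nbhs_ballP[r /= r0 yr].
  exists (r / 2); first by rewrite divr_gt0.
  move=> t /andP[t0 tr]; apply/eqP => yt0.
  have : `|y 0 - y t| < `|x|.
    apply: yr; last by rewrite /= in_itv/= t0.
    by rewrite /ball/= sub0r normrN ger0_norm//; lra.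
  by rewrite yt0 subr0 y0 ltxx.
have [intc _] := stage_cost_along_trajectory cl (ltW T0).
apply: lt_le_trans (evaluation0_ge_cost Ox cl (ltW T0)).
apply: Rintegral_itv_gt0 => // t /yT yt.
by rewrite w0; exact: lt_le_trans (ell_gt0 hS yt) (stage_cost0_ge _).
Qed.


(** This makes [w j] bounded along a trajectory on a compact interval of time,
    hence square integrable there. *)
Lemma continuous_w j k : continuous (fun x => w j x k 0).
Proof.
case: j => [|j].
  have -> : (fun x => w 0 x k 0) = cst 0 by apply/funext => x; rewrite w0 mxE.
  exact: cst_continuous.
have -> : (fun x => w j.+1 x k 0) = fun x => (2 * gam ^+ 2)^-1 *
    (invmx (Pmat S) *m (hdyn S x)^T *m gradient (V j) x) k 0.
  by apply/funext => x; rewrite wS mxE.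
suff cw : continuous
    (fun x => (invmx (Pmat S) *m (hdyn S x)^T *m gradient (V j) x) k 0).
  by move=> x; apply: (@continuousM _ _ (cst _) _ x); [exact: cst_continuous|exact: cw].
apply: continuous_mulmx => [a b|a b]; last first.
  have [_ cgrad] := V_C1 j.
  move=> z; apply: (@continuous_comp _ _ _ (gradient (V j)) (fun p : 'cV[R]_d => p a b)).
    exact: cgrad.
  exact: coord_continuous.
apply: continuous_mulmx => [e f|e f]; first exact: cst_continuous.
have -> : (fun x => (hdyn S x)^T e f) = fun x => hdyn S x f e.
  by apply/funext => z; rewrite mxE.
move=> z; apply: (@continuous_comp _ _ _ (hdyn S) (fun A : 'M[R]_(d, q) => A f e)); last first.
  exact: coord_continuous.
exact: lipschitz_continuous (h_lipschitz hS) z.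
Qed.

Lemma L2_truncated_feedback j y T : 0 <= T ->
  {within `[0, T], continuous y} ->
  measurable_vec halfline (concat T (w j \o y) (fun=> 0)) ->
  L2 halfline (concat T (w j \o y) (fun=> 0)).
Proof.
move=> T0 cy mw; split=> // k; rewrite (itv0y_setU T0).
apply: integrable_setU => //; first exact: disjoint_itv0.
  apply: (@eq_integrable _ _ _ mu _ _ (EFin \o (fun t => w j (y t) k 0 ^+ 2))) => //.
    by move=> t; rewrite inE/= in_itv/= => /andP[_ tT]; rewrite concat_le.
  apply: continuous_compact_integrable; first exact: segment_compact.
  have cw : {within `[0, T], continuous ((fun x => w j x k 0) \o y)}.
    by apply: continuous_comp_within => //; exact: continuous_w.
  by move=> t; apply: cvgM; exact: cw.
apply: (@eq_integrable _ _ _ mu _ _ (cst 0%E)) => //; last exact: integrable0.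
move=> t; rewrite inE/= in_itv/= andbT => Tt.
by rewrite concat_gt// mxE expr0n.
Qed.

(** The measurability of [ell] along a trajectory is read off the equation of
    [V 0], in which the disturbance is zero. *)
Lemma measurable_stage_cost x y (v : R -> 'cV[R]_q) :
  trajectory S halfline x (uf \o y) v y ->
  measurable_fun halfline (fun t => stage_cost (y t) (v t)).
Proof.
move=> [mu_y mv cy _].
have -> : (fun t => stage_cost (y t) (v t)) =
    (fun t => - ((gradient (V 0%N) (y t))^T *m
      (fdyn S (y t) + gdyn S (y t) *m uf (y t))) 0 0
      - gam ^+ 2 * wnorm2 (Pmat S) (v t)).
  apply/funext => t; have := pde 0 (y t).
  by rewrite w0 mulmx0 addr0 wnorm20 /stage_cost; lra.
have mhalf : measurable halfline by exact: measurable_itv.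
apply: measurable_funB; last first.
  by apply: measurable_funM; [exact: measurable_cst|exact: measurable_wnorm2].
apply: measurableT_comp => //; apply: measurable_mulmx => i j.
  rewrite [X in measurable_fun _ X](_ : _ = fun t => gradient (V 0%N) (y t) j i); last first.
    by apply/funext => t; rewrite [LHS]mxE.
  apply: within_continuous_measurable_comp => //.
  by case: (V_C1 0).
rewrite [X in measurable_fun _ X](_ : _ =
  (fun t => fdyn S (y t) i j + (gdyn S (y t) *m uf (y t)) i j)); last first.
  by apply/funext => t; rewrite [LHS]mxE.
apply: measurable_funD.
  apply: within_continuous_measurable_comp => //.
  exact: lipschitz_continuous (f_lipschitz hS).
apply: measurable_mulmx => a b; last by rewrite ord1; exact: mu_y.
apply: within_continuous_measurable_comp => //.
exact: lipschitz_continuous (g_lipschitz hS).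
Qed.

(** The competitor is the feedback [w j] up to time [T] and 0 afterwards. *)
Lemma truncated_le_worst_cost j x y T : closed_loop S uf (w j) x y ->
  0 <= T -> Omega (y T) ->
  ((V j x - V j (y T))%:E <= worst_cost S gam uf x)%E.
Proof.
move=> cl T0 OyT.
have [[y' cl'] _] := as_attractive (stable 0%N) OyT.
pose z := concat T y y'; pose v := concat T (w j \o y) (fun=> 0).
have w0E : w 0%N \o y' = fun=> 0 by apply/funext => t /=; rewrite w0.
have traj : trajectory S halfline x (uf \o z) v z.
  rewrite /z comp_concat /v -w0E; exact: trajectory_concat.
have mcost := measurable_stage_cost traj.
have [_ mv _ _] := traj; have [_ _ cy _] := cl.
apply: (@le_trans _ _ (cost S gam (uf \o z) v z)); last first.
  apply: ereal_sup_ubound; exists v, z; split=> //.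
  apply: (@L2_truncated_feedback j y) => //.
  by apply: continuous_subspaceW cy => t; rewrite /= !in_itv/= => /andP[->].
have [intc E] := stage_cost_along_trajectory cl T0.
have costE : (\int[mu]_(t in `[0%R, T]) (stage_cost (z t) (v t))%:E =
    (V j x - V j (y T))%:E)%E.
  rewrite -E /Rintegral fineK; last exact: integrable_fin_num.
  apply: eq_integral => t; rewrite inE/= in_itv/= => /andP[_ tT].
  by rewrite /z /v !concat_le.
rewrite /cost (itv0y_setU T0) integral_setU//=; last 2 first.
  by rewrite -(itv0y_setU T0); apply: measurableT_comp mcost.
  exact: disjoint_itv0.
rewrite [X in (_ <= X + _)%E]costE leeDl// integral_ge0// => t /=.
rewrite in_itv/= andbT => Tt; rewrite lee_fin /v concat_gt//.
by rewrite (le_trans (ell_ge0 (z t)))// stage_cost0_ge.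
Qed.

Lemma evaluation_le_worst_cost j x : Omega x -> ((V j x)%:E <= worst_cost S gam uf x)%E.
Proof.
move=> Ox; have [[y cl] yx] := as_attractive (stable j) Ox.
have Vy := evaluation_cvg0 j Ox cl.
have y0 := yx y cl.
apply/lee_addgt0Pr => e e0.
have : \forall T \near +oo, [/\ 0 <= T, Omega (y T) & `|V j (y T)| <= e].
  near=> T; split.
  - by near: T; exact: nbhs_pinfty_ge.
  - by near: T; exact: y0 Omega0.
  - by near: T; move/cvgr0Pnorm_le : Vy; exact.
move=> /filter_ex[T [T0 OyT VT]].
have le_worst := truncated_le_worst_cost cl T0 OyT.
apply: (@le_trans _ _ ((V j x - V j (y T))%:E + e%:E)%E); last exact: leeD2r.
by rewrite -EFinD lee_fin; have := ler_norm (V j (y T)); lra.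
Unshelve. all: by end_near.
Qed.

End policy_evaluation.

Unset Implicit Arguments.

Theorem theorem2p1 (R : realType) (d m q : nat)
  (S : game R d m q) (hS : game_assumptions S)
  (Omega : set 'cV[R]_d)
  (Omega_open : open Omega) (Omega_connected : connected Omega)
  (Omega_0 : interior Omega 0)
  (Omega_stab : closure Omega `<=` stabilizable S)
  (gamma_star gamma : R) (h_star : is_gamma_star S Omega gamma_star)
  (gamma_gt0 : 0 < gamma) (gamma_ge : gamma_star <= gamma)
  (Vgamma : 'cV[R]_d -> R)
  (Vgamma_value : forall x, (Vgamma x)%:E = value S gamma x)
  (Vgamma_unbounded : radially_unbounded Vgamma) (Vgamma_C1 : C1 Vgamma)
  (u : nat -> 'cV[R]_d -> 'cV[R]_m)
  (w : nat -> nat -> 'cV[R]_d -> 'cV[R]_q)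
  (V : nat -> nat -> 'cV[R]_d -> R)
  (Vinf : nat -> 'cV[R]_d -> R)
  (hPI : policy_iteration S Omega gamma u w V Vinf)
  (V_C1 : forall i j, C1 (V i j))
  (i : nat)
  (stable : forall j,
     asymptotically_stable (closed_loop S (u i) (w i j)) Omega) :
  (forall j x, Omega x ->
     [/\ 0 <= V i j x, V i j x <= V i j.+1 x &
         ((V i j.+1 x)%:E <= worst_cost S gamma (u i) x)%E]) /\
  (forall j x, Omega x -> x != 0 -> 0 < V i j x).
Proof.
have w0 := pi_w0 hPI i; have pde := pi_V_pde hPI i; have V0 := pi_V_0 hPI i.
have wS := pi_w hPI i; have V1 := V_C1 i.
have pos0 x : Omega x -> x != 0 -> 0 < V i 0%N x.
  exact: (evaluation0_gt0 hS w0 pde V0 V1 stable).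
have mono j x : Omega x -> V i j x <= V i j.+1 x.
  exact: (evaluation_monotone hS gamma_gt0 pde V0 wS V1 stable).
have ge0 j x : Omega x -> V i 0%N x <= V i j x.
  by move=> Ox; elim: j => // j /le_trans; apply; exact: mono.
split=> j x Ox; last by move=> x0; exact: lt_le_trans (pos0 x Ox x0) (ge0 j x Ox).
split; [|exact: mono|].
  have [->|x0] := eqVneq x 0; first by rewrite V0.
  exact: ltW (lt_le_trans (pos0 x Ox x0) (ge0 j x Ox)).
exact: (evaluation_le_worst_cost hS Omega_0 w0 pde V0 wS V1 stable).
Qed.
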